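(* Let $d\ge 4$. For $\mathbf z=(z_1,z_2,\ldots,z_d)\in\mathbb{R}^d$ write $\mathbf z=(z_1,\mathbf z_2)$ with $\mathbf z_2=(z_2,\ldots,z_d)\in\mathbb{R}^{d-1}$. Let $$A=\{(z_1,\mathbf z_2)\in\mathbb{R}^d:\ z_1>4,\ |\mathbf z_2|\le\sqrt{z_1}\},\qquad V(z_1,\mathbf z_2)=-\frac1{z_1}\,\mathbf 1_A(z_1,\mathbf z_2).$$ Then $\|\Delta^{-1}V\|_\infty<\infty$ and $\|V\|_K=\infty$. Moreover, there exists a function $V\le 0$ on $\mathbb{R}^d$ with compact support such that $\|\Delta^{-1}V\|_\infty<\infty$ but $\|V\|_K=\infty$.
   Context: Functions are Borel measurable. With $C_d=\Gamma(d/2-1)/(4\pi^{d/2})$, $$-\Delta^{-1}V(x)=C_d\int_{\mathbb{R}^d}\frac{V(z)}{|z-x|^{d-2}}\,dz,\qquad \|\Delta^{-1}V\|_\infty=\sup_{x\in\mathbb{R}^d}|\Delta^{-1}V(x)|.$$ For $x,y\in\mathbb{R}^d$ (with $x\ne0$) let $$K(x,y)=\frac{e^{-(|x||y|-x\cdot y)/2}}{|x|^{d-2}}\,(1+|x||y|)^{d/2-3/2},$$ where $x\cdot y$ is the usual scalar product, and $$\|V\|_K=\sup_{x,y\in\mathbb{R}^d}\int_{\mathbb{R}^d}|V(z)|\,K(z-x,y)\,dz.$$ $\mathbf 1_A$ denotes the indicator function of $A$. *)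

(* Defs.v *)
From HB Require Import structures.
From mathcomp Require Import all_boot all_order all_algebra lra.
From mathcomp Require Import all_classical all_reals all_analysis.
From mathcomp Require Import measurable_realfun.

Set Implicit Arguments.
Unset Strict Implicit.
Unset Printing Implicit Defensive.

Import Order.TTheory GRing.Theory Num.Theory.
Import numFieldNormedType.Exports.

Local Open Scope classical_set_scope.
Local Open Scope ring_scope.

Section borel_rV.
Context (R : realType) (n : nat).

Let G : set (set 'rV[R]_n) := @open 'rV[R]_n.

HB.instance Definition _ := @isMeasurable.Build default_measure_display 'rV[R]_n
  <<s G >> (@sigma_algebra0 _ setT G) (@sigma_algebraC _ G)
  (@sigma_algebra_bigcup _ setT G).

Lemma open_measurable_rV (A : set 'rV[R]_n) : open A -> measurable A.
Proof. exact: sub_sigma_algebra. Qed.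

End borel_rV.

Section lebesgue_measure_rV.
Context (R : realType).

Definition cons_rV n (p : R * 'rV[R]_n) : 'rV[R]_n.+1 :=
  \row_(i < n.+1) oapp (p.2 ord0) p.1 (unlift ord0 i).

Lemma cons_rV0 n (p : R * 'rV[R]_n) : cons_rV p ord0 ord0 = p.1.
Proof. by rewrite mxE unlift_none. Qed.

Lemma cons_rVS n (p : R * 'rV[R]_n) i :
  cons_rV p ord0 (lift ord0 i) = p.2 ord0 i.
Proof. by rewrite mxE liftK. Qed.

Lemma measurable_cons_rV n : measurable_fun [set: R * 'rV[R]_n] (@cons_rV n).
Proof.
pose box (t : rat * 'rV[rat]_n * rat) : set (R * 'rV[R]_n) :=
  ball (ratr t.1.1 : R) (ratr t.2) `*`
  ball (map_mx ratr t.1.2 : 'rV[R]_n) (ratr t.2).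
have mbox t : measurable (box t).
  apply: measurableX; first by apply: open_measurable; exact: ball_open.
  by apply: open_measurable_rV; exact: ball_open.
apply: (@measurability _ _ _ _ _ _ (@open 'rV[R]_n.+1)) => // _ [B oB <-].
rewrite setTI.
pose F t := if `[< box t `<=` @cons_rV n @^-1` B >] then box t else set0.
suff -> : @cons_rV n @^-1` B = \bigcup_t F t.
  apply: countable_bigcupT_measurable => // t.
  by rewrite /F; case: ifPn => // _; exact: measurable0.
apply/seteqP; split => [[x v] Bxv|p [t _]]; last first.
  by rewrite /F; case: ifPn => // /asboolP; apply.
have /nbhs_ballP[e /= e0 eB] : nbhs (cons_rV (x, v)) B by exact: open_nbhs_nbhs.
have /rat_in_itvoo[r] : 0 < e / 2 by rewrite divr_gt0.
rewrite in_itv/= => /andP[r0 re].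
have approx (y : R) : exists q : rat, ball (ratr q : R) (ratr r) y.
  have /rat_in_itvoo[q] : y - ratr r < y + ratr r :> R.
    by rewrite ltrD2l (lt_trans _ r0)// oppr_lt0.
  rewrite in_itv/= => /andP[q1 q2]; exists q.
  by rewrite /ball/= ltr_distl; apply/andP; split; lra.
have halve (c y z : R) :
    ball c (ratr r) y -> ball c (ratr r) z -> ball y e z.
  move=> cy cz; rewrite [e]splitr; apply: (@ball_triangle _ _ c).
    by apply/ball_sym; apply: le_ball cy; exact: ltW.
  by apply: le_ball cz; exact: ltW.
have [q0 q0x] := approx x.
have [q qv] := choice (fun i => approx (v ord0 i)).
exists (q0, \row_i q i, r) => //; rewrite /F ifT/=.
  split=> //; split => [|i j]/=; first exact: r0.
  by rewrite !mxE (ord1 i); exact: qv.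
apply/asboolP => -[y w] [/= q0y [_ /= qw]]; apply: eB; split=> // i j.
rewrite (ord1 i){i}; case: (unliftP ord0 j) => [k|] ->.
  by rewrite !cons_rVS/=; apply: halve (qv k) _; move: (qw ord0 k); rewrite !mxE.
by rewrite !cons_rV0; exact: halve q0x q0y.
Qed.

Definition uncons_rV n (w : 'rV[R]_n.+1) : R * 'rV[R]_n :=
  (w ord0 ord0, col' ord0 w).

Lemma cons_rVK n : cancel (@cons_rV n) (@uncons_rV n).
Proof.
move=> [x v]; rewrite /uncons_rV cons_rV0; congr pair.
by apply/rowP => i; rewrite mxE cons_rVS.
Qed.

Lemma measurable_uncons_rV n : measurable_fun [set: 'rV[R]_n.+1] (@uncons_rV n).
Proof.
apply/measurable_fun_pairP; split; last first.
  apply: (@measurability _ _ _ _ _ _ (@open 'rV[R]_n)) => // _ [B oB <-].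
  rewrite setTI; apply: open_measurable_rV; apply: open_comp => // w _.
  move=> A /= /(nbhs_ballP (col' ord0 w)) [e e0 eA].
  apply/nbhs_ballP; exists e => //= u [_ wu].
  by apply: eA; split=> // i j; rewrite !mxE; exact: wu.
apply: (measurability _ (RGenOpens.measurableE R)).
move=> _ [_ [a [b ->] <-]]; rewrite setTI; apply: open_measurable_rV.
apply: open_comp; last exact: interval_open.
by move=> w _; exact: coord_continuous.
Qed.

Section step.
Context (n : nat) (m : {sigma_finite_measure set 'rV[R]_n -> \bar R}).

Definition lebesgue_rV_step : set 'rV[R]_n.+1 -> \bar R :=
  pushforward (@lebesgue_measure R \x m)%E (@cons_rV n).

HB.instance Definition _ := Measure.copy lebesgue_rV_step
  (measure_function_pushforward__canonical__measure_function_Measure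
     (@lebesgue_measure R \x m)%E (@measurable_cons_rV n)).

Let lebesgue_rV_step_sigma_finite : sigma_finite setT lebesgue_rV_step.
Proof.
have /sigma_finiteP[F [FT ndF Foo]] := sigma_finiteT (@lebesgue_measure R).
have /sigma_finiteP[G [GT ndG Goo]] := sigma_finiteT m.
exists (fun k => @uncons_rV n @^-1` (F k `*` G k)).
  apply/seteqP; split=> // w _.
  have [i _ Fi] : (\bigcup_i F i) (w ord0 ord0) by rewrite -FT.
  have [j _ Gj] : (\bigcup_i G i) (col' ord0 w) by rewrite -GT.
  exists (maxn i j) => //; split.
  - by move: Fi; exact/subsetPset/ndF/leq_maxl.
  - by move: Gj; exact/subsetPset/ndG/leq_maxr.
move=> k; have [mF Fk] := Foo k; have [mG Gk] := Goo k.
split; first by rewrite -[X in measurable X]setTI;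
  apply: measurable_uncons_rV => //; exact: measurableX.
rewrite /lebesgue_rV_step /pushforward.
have -> : @cons_rV n @^-1` (@uncons_rV n @^-1` (F k `*` G k)) = F k `*` G k.
  by apply/funext => p; rewrite -[p in RHS]cons_rVK.
by rewrite product_measure1E// lte_mul_pinfty// ge0_fin_numE.
Qed.

HB.instance Definition _ := Measure_isSigmaFinite.Build _ _ _
  lebesgue_rV_step lebesgue_rV_step_sigma_finite.

End step.

(* Lebesgue measure on R^n: iterated product of the one on R *)
Fixpoint lebesgue_rV n : {sigma_finite_measure set 'rV[R]_n -> \bar R} :=
  if n is n'.+1 then lebesgue_rV_step (lebesgue_rV n')
  else \d_(0 : 'rV[R]_0).

End lebesgue_measure_rV.

Section potentials.
Context (R : realType).
Implicit Types (n d : nat).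

Definition enorm n (x : 'rV[R]_n) : R := Num.sqrt (\sum_i x ord0 i ^+ 2).

Definition dotp n (x y : 'rV[R]_n) : R := \sum_i x ord0 i * y ord0 i.

Definition Gamma (s : R) : R :=
  \int[@lebesgue_measure R]_(t in `]0, +oo[) (t `^ (s - 1) * expR (- t)).

Definition newton_const d : R :=
  Gamma (d%:R / 2 - 1) / (4 * pi `^ (d%:R / 2)).

(* Division by 0 yields 0, so the integrands below vanish at z = x, which is  *)
(* a null set; d - 2 is truncated subtraction, meant for d >= 2.              *)
Definition inv_laplacian d (V : 'rV[R]_d -> R) (x : 'rV[R]_d) : \bar R :=
  (- ((newton_const d)%:E *
      \int[lebesgue_rV R d]_z (V z / enorm (z - x) ^+ (d - 2))%:E))%E.

Definition inv_laplacian_norm d (V : 'rV[R]_d -> R) : \bar R :=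
  ereal_sup [set `|inv_laplacian V x|%E | x in [set: 'rV[R]_d]].

Definition kerK d (x y : 'rV[R]_d) : R :=
  expR (- (enorm x * enorm y - dotp x y) / 2) / enorm x ^+ (d - 2)
  * (1 + enorm x * enorm y) `^ (d%:R / 2 - 3 / 2).

Definition normK d (V : 'rV[R]_d -> R) : \bar R :=
  ereal_sup [set (\int[lebesgue_rV R d]_z (`|V z| * kerK (z - x) y)%:E)%E
            | x in [set: 'rV[R]_d] & y in [set: 'rV[R]_d]].

(* The ambient space is R^n.+1: z_1 is z ord0 ord0, and (z_2, ..., z_n.+1) is *)
(* col' ord0 z.                                                               *)
Definition setA n : set 'rV[R]_n.+1 :=
  [set z : 'rV[R]_n.+1 |
    4 < z ord0 ord0 /\ enorm (col' ord0 z) <= Num.sqrt (z ord0 ord0)].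

Definition potV n (z : 'rV[R]_n.+1) : R := - (z ord0 ord0)^-1 * \1_(@setA n) z.

End potentials.

(* Main.v *)
Require Import Defs.
From mathcomp Require Import all_boot all_order all_algebra.
From mathcomp Require Import all_classical all_reals all_analysis.
From mathcomp Require Import measurable_realfun zify lra ring.

(** For lam > 0 put W_lam = (lam / z_1) 1[lam z_1 > 4, |z_2| <= sqrt (z_1 / lam)],
    the rescaling lam^2 W_1 (lam z) of W_1 = -V.

    Cut W_lam into the pieces k^2 <= lam z_1 <= (k+1)^2: each has size about
    r = k / lam in every direction and W_lam is about 1 / r^2 there, so its
    Newtonian potential is O(1) everywhere, and O(1 / t^2) at x if
    lam x_1 lies t pieces away.  Summing over k bounds the potential of W_lam
    uniformly in x and lam.

    With x = 0 and y = lam e_1, the exponent |z||y| - z.y is at most 1 on the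
    support of W_lam, and each slab q^2 <= lam z_1 <= 2 q^2 contributes a constant
    independent of q and lam to the integral defining the K-norm, so this norm is
    infinite.  For compact support, sum 2^-j W_(lam_j) 1[z_1 <= 2^-j], with lam_j so
    large that the cut-off keeps 4^j slabs of W_(lam_j). *)

Set Implicit Arguments.
Unset Strict Implicit.

Import Order.TTheory GRing.Theory Num.Theory.
Import numFieldNormedType.Exports.

Local Open Scope classical_set_scope.
Local Open Scope ring_scope.

(** * Measurability on row vectors and the Euclidean norm *)

Lemma continuous_measurable_rV (R : realType) n (f : 'rV[R]_n -> R) :
  continuous f -> measurable_fun setT f.
Proof.
move=> cf; apply: (measurability _ (RGenOpens.measurableE R)).
move=> _ [_ [a [b ->] <-]]; rewrite setTI; apply: open_measurable_rV.
by apply: open_comp; [move=> w _; exact: cf|exact: interval_open].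
Qed.

Lemma measurable_coord (R : realType) n (i : 'I_n) :
  measurable_fun setT (fun z : 'rV[R]_n => z ord0 i).
Proof. by apply: continuous_measurable_rV; exact: coord_continuous. Qed.

Lemma measurable_sqrtr (R : realType) : measurable_fun setT (@Num.sqrt R).
Proof. by apply: continuous_measurable_fun; exact: sqrt_continuous. Qed.

(** On nonnegative reals the inverse is the power [-1], which is measurable; at 0 both take the
    value 0. *)
Lemma measurable_invr_ge0 (R : realType) d (T : measurableType d) (f : T -> R) :
  (forall x, 0 <= f x) -> measurable_fun setT f ->
  measurable_fun setT (fun x => (f x)^-1).
Proof.
move=> f0 mf; rewrite (_ : (fun _ => _) = (fun x => f x `^ (-1))).
  exact: measurableT_comp (measurable_powR _) mf.
by apply/funext => x; rewrite powR_inv1.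
Qed.

Lemma enorm_ge0 (R : realType) n (x : 'rV[R]_n) : 0 <= enorm x.
Proof. exact: sqrtr_ge0. Qed.

Lemma measurable_enorm_sub (R : realType) n (x : 'rV[R]_n) :
  measurable_fun setT (fun z : 'rV[R]_n => enorm (z - x)).
Proof.
rewrite (_ : (fun _ => _) =
  Num.sqrt \o (fun z : 'rV[R]_n => \sum_(i < n) (z ord0 i - x ord0 i) ^+ 2)); last first.
  by apply/funext => z; congr Num.sqrt; apply: eq_bigr => i _; rewrite !mxE.
apply: measurableT_comp; first exact: measurable_sqrtr.
apply: measurable_sum => i; apply: measurable_funX.
by apply: measurable_funB; [exact: measurable_coord|exact: measurable_cst].
Qed.

Lemma sqr_enorm (R : realType) n (x : 'rV[R]_n) :
  enorm x ^+ 2 = \sum_i x ord0 i ^+ 2.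
Proof. by rewrite sqr_sqrtr// sumr_ge0// => i _; exact: sqr_ge0. Qed.

Lemma norm_coord_le_enorm (R : realType) n (x : 'rV[R]_n) i :
  `|x ord0 i| <= enorm x.
Proof.
rewrite -(ler_pXn2r (_ : 0 < 2)%N)// ?nnegrE ?enorm_ge0// sqr_enorm real_normK ?num_real//.
by rewrite (bigD1 i)//= lerDl sumr_ge0// => j _; exact: sqr_ge0.
Qed.

(** * Boxes and their Lebesgue measure *)

Definition box (R : realType) n (a b : 'rV[R]_n) : set 'rV[R]_n :=
  [set z | forall i, a ord0 i <= z ord0 i <= b ord0 i].

Lemma measurable_box (R : realType) n (a b : 'rV[R]_n) : measurable (box a b).
Proof.
rewrite (_ : box a b =
  \bigcap_(i in [set: 'I_n]) [set z | z ord0 i \in `[a ord0 i, b ord0 i]]).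
  apply: fin_bigcap_measurable => // i _.
  have := @measurable_coord R n i measurableT _
    (measurable_itv `[a ord0 i, b ord0 i]).
  by rewrite setTI.
by apply/seteqP; split=> z /= h i => [_|]; [|have := h i I]; rewrite /= in_itv/=.
Qed.

Lemma lebesgue_box (R : realType) n (a b : 'rV[R]_n) :
  (forall i, a ord0 i <= b ord0 i) ->
  lebesgue_rV R n (box a b) = (\prod_i (b ord0 i - a ord0 i))%:E.
Proof.
elim: n a b => [|n ih] a b ab.
  rewrite big_ord0 /= diracE mem_set//.
  by case.
rewrite /= /lebesgue_rV_step /pushforward.
pose a' := col' ord0 a; pose b' := col' ord0 b.
have -> : @cons_rV R n @^-1` box a b = `[a ord0 ord0, b ord0 ord0] `*` box a' b'.
  apply/seteqP; split => [[x v]/= h|[x v]/= [h1 h2] i].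
    split=> [|i]; first by move: (h ord0); rewrite in_itv/= cons_rV0.
    by rewrite !mxE; move: (h (lift ord0 i)); rewrite cons_rVS.
  case: (unliftP ord0 i) => [j|] ->; last by rewrite cons_rV0/=; rewrite in_itv in h1.
  by rewrite cons_rVS; move: (h2 j); rewrite !mxE.
rewrite product_measure1E//; last exact: measurable_box.
rewrite ih => [|i]; last by rewrite !mxE.
rewrite big_ord_recl EFinM; congr (_ * _)%E.
  apply: (etrans (lebesgue_measure_itv `[a ord0 ord0, b ord0 ord0])).
  (* The interval formula distinguishes [a < b]; in the degenerate case both sides are 0. *)
  rewrite /= lte_fin; case: ifPn => // /negbTE.
  by rewrite lt_neqAle ab andbT => /negbFE/eqP ->; rewrite subrr.
by congr EFin; apply: eq_bigr => i _; rewrite !mxE.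
Qed.

(** * Integrals of the Riesz kernel over sets of bounded volume *)

Lemma nneseries_EFin_le (R : realType) (u : nat -> R) (M : R) :
  (forall i, 0 <= u i) -> (forall N, \sum_(0 <= i < N) u i <= M) ->
  (\sum_(0 <= i <oo) (u i)%:E <= M%:E)%E.
Proof.
move=> u0 uM; apply: lime_le.
  by apply: is_cvg_nneseries => i _ _; rewrite lee_fin.
by apply: nearW => N; rewrite sumEFin lee_fin.
Qed.

Lemma sum_half_le (R : realType) N : \sum_(0 <= i < N) (2^-1 : R) ^+ i <= 2.
Proof.
suff -> : \sum_(0 <= i < N) (2^-1 : R) ^+ i = 2 - 2 * 2^-1 ^+ N.
  by rewrite lerBlDr lerDl mulr_ge0// exprn_ge0// invr_ge0.
elim: N => [|N ih]; first by rewrite big_nil expr0 mulr1 subrr.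
by rewrite big_nat_recr//= ih exprS; lra.
Qed.

(** The sup-norm ball stands in for the Euclidean ball of radius [r], which it contains, because its
    volume is explicit. *)
Definition cube (R : realType) n (x : 'rV[R]_n) (r : R) : set 'rV[R]_n :=
  box (\row_i (x ord0 i - r)) (\row_i (x ord0 i + r)).

Lemma lebesgue_cube (R : realType) n (x : 'rV[R]_n) (r : R) : 0 <= r ->
  lebesgue_rV R n (cube x r) = ((2 * r) ^+ n)%:E.
Proof.
move=> r0; rewrite lebesgue_box => [|i]; last by rewrite !mxE; lra.
congr EFin; rewrite -[in RHS](card_ord n) -prodr_const.
by apply: eq_bigr => i _; rewrite !mxE; lra.
Qed.

Lemma measurable_riesz (R : realType) n p (x : 'rV[R]_n) :
  measurable_fun setT (fun z : 'rV[R]_n => (enorm (z - x) ^+ p)^-1).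
Proof.
apply: measurable_invr_ge0 => [z|]; first by rewrite exprn_ge0// enorm_ge0.
by apply: measurable_funX; exact: measurable_enorm_sub.
Qed.

Lemma riesz_ge0 (R : realType) n p (x z : 'rV[R]_n) :
  0 <= (enorm (z - x) ^+ p)^-1.
Proof. by rewrite invr_ge0 exprn_ge0// enorm_ge0. Qed.

(* At z = x the left-hand side is the junk value 0^-1 = 0. *)
Lemma riesz_dyadic (R : realType) n p (x z : 'rV[R]_n) (r : R) :
  (0 < p)%N -> 0 < r ->
  (((enorm (z - x) ^+ p)^-1)%:E <= ((r ^+ p)^-1)%:E +
    \sum_(0 <= i <oo)
      ((2 ^+ i.+1 / r) ^+ p * \1_(cube x (r / 2 ^+ i)) z)%:E)%E.
Proof.
move=> p0 r0; set e := enorm _.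
pose u i := (2 ^+ i.+1 / r) ^+ p * \1_(cube x (r / 2 ^+ i)) z.
have u0 i : (0 <= (u i)%:E)%E.
  by rewrite lee_fin mulr_ge0// exprn_ge0// divr_ge0// ltW.
have S0 : (0 <= \sum_(0 <= i <oo) (u i)%:E)%E by exact: nneseries_ge0.
have [re|er] := leP r e.
  apply: (@le_trans _ _ ((r ^+ p)^-1)%:E); last by rewrite leeDl.
  by rewrite lee_fin lef_pV2 ?posrE ?exprn_gt0// ?(lt_le_trans r0)//
    lerXn2r// nnegrE ltW// (lt_le_trans r0).
have rp0 : (0 <= ((r ^+ p)^-1)%:E)%E by rewrite lee_fin invr_ge0 exprn_ge0// ltW.
have := enorm_ge0 (z - x); rewrite -/e le_eqVlt => /predU1P[<-|e0].
  by rewrite expr0n gtn_eqF//= invr0 adde_ge0.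
have ex : exists i, r / 2 ^+ i.+1 <= e.
  have [m rm] : exists m : nat, r / e < m%:R.
    by exists (Num.truncn (r / e)).+1; exact: truncnS_gt.
  exists m; rewrite ler_pdivrMr ?exprn_gt0// mulrC -ler_pdivrMr//.
  rewrite (le_trans (ltW rm))// -natrX ler_nat.
  by rewrite (leq_trans (ltnW (ltn_expl m (isT : 1 < 2)%N)))// leq_exp2l.
(* [i] indexes the dyadic shell of [z]: minimality gives [e <= r / 2 ^+ i], or [e < r] does if
   [i = 0]. The [i]-th term alone then dominates the kernel. *)
pose i := ex_minn ex.
have [ie ei] : r / 2 ^+ i.+1 <= e /\ e <= r / 2 ^+ i.
  rewrite /i; case: ex_minnP => -[|j] h hm; split=> //.
    by rewrite expr0 divr1 ltW.
  by rewrite leNgt; apply/negP => /ltW/hm; rewrite ltnn.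
apply: (@le_trans _ _ (u i)%:E); last first.
  apply: (@le_trans _ _ (\sum_(0 <= j <oo) (u j)%:E)%E); last by rewrite leeDr.
  have := @nneseries_lim_ge R (fun j => (u j)%:E) xpredT 0 i.+1 (fun j _ _ => u0 j).
  by apply: le_trans; rewrite big_nat_recr//= leeDr// sume_ge0.
rewrite lee_fin /u indicE mem_set ?mulr1.
  rewrite -exprVn; apply: lerXn2r; rewrite ?nnegrE ?invr_ge0 ?divr_ge0 ?(ltW e0) ?(ltW r0)//.
  by rewrite -[2 ^+ i.+1 / r]invf_div lef_pV2 ?posrE// divr_gt0// exprn_gt0.
move=> j; rewrite !mxE -ler_distl.
have := norm_coord_le_enorm (z - x) j; rewrite !mxE => /le_trans -> //.
Qed.

(** The dyadic bound is integrated term by term. The constant term gives at most $2^{p+2} r^2$, and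
    the $i$-th cube gives at most $2^{p+2} 2^p r^2 4^{-i}$. The position of [x] relative to [D] does
    not enter. *)
Lemma integral_riesz_le (R : realType) p (x : 'rV[R]_p.+2) (r : R)
    (D : set 'rV[R]_p.+2) :
  (0 < p)%N -> 0 < r -> measurable D ->
  (lebesgue_rV R p.+2 D <= ((2 * r) ^+ p.+2)%:E)%E ->
  (\int[lebesgue_rV R p.+2]_(z in D) ((enorm (z - x) ^+ p)^-1)%:E
    <= (2 ^+ p.+2 * (1 + 2 ^+ p.+1) * r ^+ 2)%:E)%E.
Proof.
move=> p0 r0 mD Dr; set mu := lebesgue_rV R p.+2.
pose u i z := (((2 ^+ i.+1 / r) ^+ p * \1_(cube x (r / 2 ^+ i)) z)%:E : \bar R).
have u0 i z : (0 <= u i z)%E.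
  by rewrite lee_fin mulr_ge0// exprn_ge0// divr_ge0// ltW.
have mu_ i : measurable_fun D (u i).
  apply/measurable_EFinP; apply: measurable_funM; first exact: measurable_cst.
  by apply: measurable_indic; exact: measurable_box.
have mS : measurable_fun D (fun z => \sum_(0 <= i <oo) u i z)%E.
  by apply: ge0_emeasurable_sum => // *; exact: u0.
have rp0 : (0 <= ((r ^+ p)^-1)%:E)%E by rewrite lee_fin invr_ge0 exprn_ge0// ltW.
apply: (@le_trans _ _ (\int[mu]_(z in D) (((r ^+ p)^-1)%:E +
    \sum_(0 <= i <oo) u i z))%E).
  apply: ge0_le_integral => //.
  - by move=> z _; rewrite lee_fin riesz_ge0.
  - apply/measurable_EFinP; apply: measurable_funS (measurable_riesz p x) => //.
  - by apply: emeasurable_funD => //; exact: measurable_cst.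
  - by move=> z _; exact: riesz_dyadic.
rewrite ge0_integralD//; last by move=> z _; exact: nneseries_ge0.
rewrite integral_cst// integral_nneseries//.
rewrite mulrDr mulr1 mulrDl EFinD leeD//.
  apply: le_trans (lee_wpmul2l rp0 Dr) _; rewrite -EFinM lee_fin.
  rewrite exprMn mulrCA ler_wpM2l ?exprn_ge0//.
  by rewrite -addn2 exprD mulrA mulVf ?mul1r// expf_neq0// gt_eqF.
pose c : R := 2 ^+ p.+2 * 2 ^+ p * r ^+ 2.
have c0 : 0 <= c by rewrite mulr_ge0 ?sqr_ge0// -exprD exprn_ge0.
apply: (@le_trans _ _ (\sum_(0 <= i <oo) (c * 2^-1 ^+ i)%:E)%E); last first.
  apply: nneseries_EFin_le => [i|N].
    by rewrite mulr_ge0// exprn_ge0// invr_ge0.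
  rewrite -mulr_sumr (_ : _ * _ * _ = c * 2); last by rewrite /c (exprS _ p); ring.
  by rewrite ler_wpM2l// sum_half_le.
apply: lee_nneseries => [i _ _|i _]; first exact: integral_ge0.
rewrite /u; under eq_integral do rewrite EFinM.
rewrite ge0_integralZl_EFin//; last 2 first.
- by apply/measurable_EFinP; apply: measurable_indic; exact: measurable_box.
- by rewrite exprn_ge0// divr_ge0// ltW.
rewrite integral_indic//; last exact: measurable_box.
apply: (@le_trans _ _ (((2 ^+ i.+1 / r) ^+ p)%:E * mu (cube x (r / 2 ^+ i)))%E).
  apply: lee_wpmul2l; first by rewrite lee_fin exprn_ge0// divr_ge0// ltW.
  apply: le_measure; rewrite ?inE//.
    by apply: measurableI => //; exact: measurable_box.
  exact: measurable_box.
rewrite lebesgue_cube; last by rewrite divr_ge0// ltW.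
rewrite -EFinM lee_fin.
have -> : (2 ^+ i.+1 / r) ^+ p * (2 * (r / 2 ^+ i)) ^+ p.+2 =
    c * (2^-1 ^+ i) ^+ 2.
  have q0 : (2 : R) ^+ i != 0 by rewrite expf_neq0.
  rewrite exprVn [2 ^+ i.+1]exprS; set q := 2 ^+ i in q0 *.
  rewrite /c !exprMn !exprVn !exprS; field.
  by rewrite !expf_neq0 ?gt_eqF// q0 gt_eqF.
(* The factor $4^{-i}$ is weakened to $2^{-i}$, whose partial sums are at most 2. *)
rewrite ler_wpM2l// expr2 ler_piMr ?exprn_ge0 ?invr_ge0//.
by rewrite exprn_ile1 ?invr_ge0// invf_le1// ler1n.
Qed.

(** On [D] the kernel is at most $(sr)^{-p}$, so the integral is at most $2^{p+2} r^2 s^{-p}$. Since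
    $p \ge 2$, that is, in dimension at least 4, and $s \ge 1$, this decays at least like $s^{-2}$,
    which is summable over blocks. *)
Lemma integral_riesz_far (R : realType) p (x : 'rV[R]_p.+2) (r s : R)
    (D : set 'rV[R]_p.+2) : (2 <= p)%N ->
  0 < r -> 1 <= s -> measurable D ->
  (lebesgue_rV R p.+2 D <= ((2 * r) ^+ p.+2)%:E)%E ->
  (forall z, D z -> s * r <= enorm (z - x)) ->
  (\int[lebesgue_rV R p.+2]_(z in D) ((enorm (z - x) ^+ p)^-1)%:E
    <= (2 ^+ p.+2 * r ^+ 2 / s ^+ 2)%:E)%E.
Proof.
move=> p2 r0 s1 mD Dr far; have s0 : 0 < s by rewrite (lt_le_trans _ s1).
have sr0 : 0 < s * r by rewrite mulr_gt0.
apply: (@le_trans _ _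
    (\int[lebesgue_rV R p.+2]_(z in D) (cst ((s * r) ^+ p)^-1%:E) z)%E).
  apply: ge0_le_integral => //.
  - by move=> z _; rewrite lee_fin riesz_ge0.
  - by apply/measurable_EFinP; apply: measurable_funS (measurable_riesz p x).
  - move=> z Dz; have h := far _ Dz; rewrite lee_fin lef_pV2 ?posrE ?exprn_gt0//.
      by rewrite lerXn2r// nnegrE ltW// (lt_le_trans sr0).
    exact: lt_le_trans h.
rewrite integral_cst//.
apply: le_trans (lee_wpmul2l _ Dr) _; first by rewrite lee_fin invr_ge0 exprn_ge0// ltW.
rewrite -EFinM lee_fin.
have -> : ((s * r) ^+ p)^-1 * (2 * r) ^+ p.+2 =
    2 ^+ p.+2 * r ^+ 2 * (s ^+ p)^-1.
  by rewrite !exprMn !exprS; field; rewrite !expf_neq0 ?gt_eqF.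
apply: ler_wpM2l; first by rewrite mulr_ge0 ?sqr_ge0 ?exprn_ge0.
rewrite lef_pV2 ?posrE ?exprn_gt0//.
by rewrite ler_weXn2l.
Qed.

(** * Tubes around the first axis and the rescaled potentials *)

Definition tube (R : realType) n (a b c : R) : set 'rV[R]_n.+1 :=
  box (\row_i (if i == ord0 then a else - c)) (\row_i (if i == ord0 then b else c)).

Lemma tubeP (R : realType) n (a b c : R) (z : 'rV[R]_n.+1) :
  tube a b c z <-> a <= z ord0 ord0 <= b /\
    forall j : 'I_n, `|z ord0 (lift ord0 j)| <= c.
Proof.
split=> [h|[h1 h2] i].
  split=> [|j]; first by have := h ord0; rewrite !mxE eqxx.
  by have := h (lift ord0 j); rewrite !mxE eq_sym (negbTE (neq_lift _ _)) ler_norml.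
rewrite !mxE; case: (unliftP ord0 i) => [j|] ->; last by rewrite eqxx.
by rewrite eq_sym (negbTE (neq_lift _ _)) -ler_norml.
Qed.

Lemma measurable_tube (R : realType) n (a b c : R) : measurable (@tube R n a b c).
Proof. exact: measurable_box. Qed.

Lemma lebesgue_tube (R : realType) n (a b c : R) : a <= b -> 0 <= c ->
  lebesgue_rV R n.+1 (tube a b c) = ((b - a) * (2 * c) ^+ n)%:E.
Proof.
move=> ab c0; rewrite lebesgue_box => [|i]; last first.
  by rewrite !mxE; case: ifP => // _; lra.
congr EFin; rewrite big_ord_recl !mxE eqxx; congr (_ * _).
rewrite -[in RHS](card_ord n) -prodr_const; apply: eq_bigr => i _.
by rewrite !mxE eq_sym (negbTE (neq_lift _ _)); lra.
Qed.

Definition parabola (R : realType) n (lam : R) : set 'rV[R]_n.+1 :=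
  [set z : 'rV[R]_n.+1 | 4 < lam * z ord0 ord0 /\
    enorm (col' ord0 z) <= Num.sqrt (z ord0 ord0 / lam)].

Definition parabV (R : realType) n (lam : R) (z : 'rV[R]_n.+1) : R :=
  lam / z ord0 ord0 * \1_(@parabola R n lam) z.

Lemma potVE (R : realType) n (z : 'rV[R]_n.+1) : potV z = - parabV 1 z.
Proof.
rewrite /potV /parabV div1r mulNr; congr (- (_ * \1__ z)).
by apply/seteqP; split => w; rewrite /setA /parabola /= mul1r divr1.
Qed.

Lemma measurable_enorm_col' (R : realType) n :
  measurable_fun setT (fun z : 'rV[R]_n.+1 => enorm (col' ord0 z)).
Proof.
have m0 : measurable_fun setT (@enorm R n).
  have := measurable_enorm_sub (0 : 'rV[R]_n).
  by rewrite (_ : (fun _ => _) = @enorm R n)//; apply/funext => z; rewrite subr0.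
have m1 : measurable_fun setT (snd \o @uncons_rV R n).
  by apply: measurableT_comp => //; exact: measurable_uncons_rV.
exact: (measurableT_comp m0 m1).
Qed.

Lemma measurable_parabola (R : realType) n (lam : R) :
  measurable (@parabola R n lam).
Proof.
have m0 c : measurable_fun setT (fun z : 'rV[R]_n.+1 => c * z ord0 ord0).
  by apply: measurable_funM; [exact: measurable_cst|exact: measurable_coord].
have mg : measurable_fun setT (fun z : 'rV[R]_n.+1 =>
    Num.sqrt (lam^-1 * z ord0 ord0) - enorm (col' ord0 z)).
  apply: measurable_funB; last exact: measurable_enorm_col'.
  by apply: measurableT_comp (m0 _); exact: measurable_sqrtr.
have := measurableI _ _ (m0 lam measurableT _ (measurable_itv `]4, +oo[))
  (mg measurableT _ (measurable_itv `[0, +oo[)).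
rewrite !setTI (_ : _ `&` _ = @parabola R n lam)//.
by apply/seteqP; split => z; rewrite /= !in_itv/= !andbT subr_ge0 [lam^-1 * _]mulrC.
Qed.

Lemma parabola_gt0 (R : realType) n (lam : R) (z : 'rV[R]_n.+1) :
  0 < lam -> parabola lam z -> 0 < z ord0 ord0.
Proof.
by move=> l0 [h _]; rewrite -(pmulr_rgt0 _ l0) (lt_trans _ h).
Qed.

Lemma parabV_ge0 (R : realType) n (lam : R) (z : 'rV[R]_n.+1) :
  0 < lam -> 0 <= parabV lam z.
Proof.
move=> l0; rewrite /parabV indicE; case: (boolP (z \in _)) => [|_].
  by rewrite inE => /(parabola_gt0 l0) z0; rewrite mulr1 divr_ge0// ltW.
by rewrite mulr0.
Qed.

Lemma measurable_parabV (R : realType) n (lam : R) : 0 < lam ->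
  measurable_fun setT (@parabV R n lam).
Proof.
move=> l0.
(* [powR] is measurable and agrees with the inverse at positive [z ord0 ord0], hence on the
   parabola; elsewhere the indicator makes both sides 0. *)
have -> : @parabV R n lam =
    (fun z => lam * z ord0 ord0 `^ (-1) * \1_(parabola lam) z).
  apply/funext => z; rewrite /parabV indicE; case: (boolP (z \in _)) => [|_].
    by rewrite inE => /(parabola_gt0 l0)/ltW z0; rewrite powR_inv1.
  by rewrite !mulr0.
apply: measurable_funM.
  apply: measurable_funM; first exact: measurable_cst.
  by apply: measurableT_comp (measurable_powR _) _; exact: measurable_coord.
by apply: measurable_indic; exact: measurable_parabola.
Qed.

(** * Decomposition into blocks and the bound on the Newtonian potential *)

Lemma sqrt_floor (R : realType) (y : R) : 0 <= y ->
  exists k : nat, k%:R ^+ 2 <= y < k.+1%:R ^+ 2.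
Proof.
move=> y0; exists (Num.truncn (Num.sqrt y)).
have /andP[h1 h2] := truncn_itv (sqrtr_ge0 y).
rewrite -[y in _ <= y]sqr_sqrtr// -[y in y < _]sqr_sqrtr//.
by rewrite lerXn2r ?nnegrE ?sqrtr_ge0//= ltrXn2r// nnegrE ?sqrtr_ge0.
Qed.

(** This is $|k-j|$: subtraction is truncated, so at most one summand is nonzero. *)
Definition ndist (k j : nat) := (k - j + (j - k))%N.

Lemma ndist_addr k t : ndist k (k + t) = t.
Proof. by rewrite /ndist; lia. Qed.

Lemma ndist_addl k t : ndist (k + t) k = t.
Proof. by rewrite /ndist; lia. Qed.

(* Telescopes on each side of j. *)
Lemma sum_inv_ndist_le (R : realType) (j N : nat) :
  \sum_(0 <= k < N) (((ndist k j).+1)%:R * ((ndist k j).+2)%:R)^-1 <= 2 :> R.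
Proof.
have fwd (t : R) : 0 <= t ->
    (t + 1 + 1)^-1 + ((t + 1 + 1) * (t + 1 + 1 + 1))^-1 <= (t + 1)^-1.
  move=> t0.
  rewrite -subr_ge0 (_ : _ - _ = 2 / ((t + 1) * (t + 1 + 1) * (t + 1 + 1 + 1))).
    by rewrite divr_ge0// !mulr_ge0//; lra.
  by field; apply/and3P; split; rewrite gt_eqF//; lra.
have bwd (t : R) : 0 <= t -> 2 - (t + 1 + 1)^-1 +
    ((t + 1 + 1) * (t + 1 + 1 + 1))^-1 <= 2 - (t + 1 + 1 + 1)^-1.
  move=> t0; rewrite -subr_ge0 (_ : _ - _ = 0)//.
  by field; apply/andP; split; rewrite gt_eqF//; lra.
(* Strengthened for the induction on [N]: the bound rises to 1 at [N = j], the term [k = j] is 1/2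
   and leads to [2 - 1/2], and from there the sum telescopes towards 2. *)
suff : \sum_(0 <= k < N) (((ndist k j).+1)%:R * ((ndist k j).+2)%:R)^-1 <=
    (if (N <= j)%N then (j - N).+1%:R^-1 else 2 - (N - j).+1%:R^-1) :> R.
  move=> /le_trans; apply; case: ifP => _; last by rewrite lerBlDr lerDl.
  by rewrite (@le_trans _ _ 1)// ?ler1n// invf_le1// ler1n.
elim: N => [|N ih]; first by rewrite big_nil.
rewrite big_nat_recr//=; apply: le_trans (lerD ih (lexx _)) _ => {ih}.
have [jN|Nj|->] := ltngtP N j.
- rewrite -(subnKC jN) addSnnS ndist_addr; move: (j - N.+1)%N => s.
  rewrite addKn -addSnnS addKn.
  rewrite -!natr1; apply: (fwd s%:R); exact: ler0n.
- rewrite -(subnKC Nj) addSnnS ndist_addl; move: (N - j.+1)%N => s.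
  rewrite -addnS !addKn.
  rewrite -!natr1 !add0r -[1 + 1]/2%:R; apply: (bwd s%:R); exact: ler0n.
- by rewrite /ndist subnn subSnn addn0 invr1 mul1r; lra.
Qed.

(* On this block parabV lam is at most lam^2 / k^2, and the block has measure at
   most that of a cube of half-side (k+1) / lam. *)
Definition block (R : realType) n (lam : R) (k : nat) : set 'rV[R]_n.+1 :=
  tube (k%:R ^+ 2 / lam) (k.+1%:R ^+ 2 / lam) (k.+1%:R / lam).

(** The first side has length $(2k+1)/lam$, which is below the length $2(k+1)/lam$ of the others. *)
Lemma block_volume (R : realType) n (lam : R) k : 0 < lam ->
  (lebesgue_rV R n.+1 (@block R n lam k) <= ((2 * (k.+1%:R / lam)) ^+ n.+1)%:E)%E.
Proof.
move=> l0; have r0 : 0 <= k.+1%:R / lam by rewrite divr_ge0// ltW.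
rewrite lebesgue_tube//; last first.
  by rewrite ler_pM2r ?invr_gt0// lerXn2r ?nnegrE// ler_nat.
rewrite lee_fin [leRHS]exprS ler_wpM2r ?exprn_ge0 ?mulr_ge0 ?invr_ge0 ?(ltW l0)//.
rewrite -mulrBl mulrA ler_pM2r ?invr_gt0//.
by rewrite -[k.+1%:R]natr1; lra.
Qed.

(** First coordinates suffice. With $t = |k-j|$, those of [z] and [x], scaled by [lam], differ by at
    least $(t-1)(k+j+1)$, a difference of two squares. The maximum with 0 assigns [j = 0] to points
    with negative first coordinate. *)
Lemma block_far (R : realType) n (lam : R) (k j : nat) (x z : 'rV[R]_n.+1) :
  0 < lam -> j%:R ^+ 2 <= Num.max 0 (lam * x ord0 ord0) < j.+1%:R ^+ 2 ->
  (2 <= ndist k j)%N -> block lam k z ->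
  (ndist k j).-1%:R * (k.+1%:R / lam) <= enorm (z - x).
Proof.
move=> l0 /andP[jx xj] t2 /tubeP[/andP[z1 z2] _].
have := norm_coord_le_enorm (z - x) ord0; rewrite !mxE; apply: le_trans.
rewrite mulrA ler_pdivrMr//; move: z1 z2.
rewrite ler_pdivrMr// ler_pdivlMr// [_ * lam]mulrC => z1 z2.
have aE : `|z ord0 ord0 - x ord0 ord0| * lam =
    `|lam * z ord0 ord0 - lam * x ord0 ord0|.
  by rewrite -mulrBr normrM gtr0_norm// mulrC.
rewrite aE {aE}; move: (lam * z ord0 ord0) (lam * x ord0 ord0) z1 z2 jx xj => u v.
have [jk|kj] := leqP j k.
  have [t kE] : exists t, k = (j + t)%N by exists (k - j)%N; rewrite subnKC.
  move: t2; rewrite kE ndist_addl; case: t kE => [//|t] kE _ z1 z2 jx xj /=.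
  apply: le_trans (ler_norm _).
  have : v < j.+1%:R ^+ 2 by rewrite (le_lt_trans _ xj)// le_max lexx orbT.
  move: z1; rewrite addnS -!natr1 natrD => z1 vj.
  have := ler0n R j; have := ler0n R t; move: (j%:R : R) (t%:R : R) z1 vj => a b.
  by move=> z1 vj b0 a0; nra.
have [t jE] : exists t, j = (k + t)%N by exists (j - k)%N; rewrite subnKC// ltnW.
move: t2; rewrite jE ndist_addr; case: t jE => [//|t] jE _ z1 z2 jx xj /=.
rewrite distrC; apply: le_trans (ler_norm _).
(* Here [j > 0], so the maximum with 0 must be [v] itself. *)
have : (k + t.+1)%:R ^+ 2 <= v.
  by move: jx; rewrite le_max leNgt exprn_gt0//= ltr0n addnS.
move: z2; rewrite addnS -!natr1 natrD => z2 vj.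
have := ler0n R k; have := ler0n R t; move: (k%:R : R) (t%:R : R) z2 vj => a b.
by move=> z2 vj b0 a0; nra.
Qed.

Definition riesz_cst (R : realType) p : R := 2 ^+ p.+2 * (1 + 2 ^+ p.+1).

(** Blocks at distance $t \le 1$ use the volume bound, the others the far bound with $s = t-1$. The
    factor $1/((t+1)(t+2))$ is chosen to telescope, and 12 makes $1/(t-1)^2 \le 12/((t+1)(t+2))$ for
    all $t \ge 2$, with equality at $t = 2$. *)
Lemma block_riesz_le (R : realType) p (lam : R) (k j : nat) (x : 'rV[R]_p.+2) :
  (2 <= p)%N -> 0 < lam ->
  j%:R ^+ 2 <= Num.max 0 (lam * x ord0 ord0) < j.+1%:R ^+ 2 ->
  (\int[lebesgue_rV R p.+2]_(z in block lam k) ((enorm (z - x) ^+ p)^-1)%:E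
    <= (12 * riesz_cst R p * (k.+1%:R / lam) ^+ 2 *
        ((ndist k j).+1%:R * (ndist k j).+2%:R)^-1)%:E)%E.
Proof.
move=> p2 l0 jx; set r := k.+1%:R / lam.
have r0 : 0 < r by rewrite divr_gt0.
have mB : measurable (@block R p.+1 lam k) by exact: measurable_tube.
have c0 : 0 <= riesz_cst R p * r ^+ 2.
  by rewrite mulr_ge0 ?sqr_ge0// mulr_ge0 ?exprn_ge0// addr_ge0// exprn_ge0.
have -> v : 12 * riesz_cst R p * r ^+ 2 * v = riesz_cst R p * r ^+ 2 * (12 * v).
  by ring.
have [t2|t1] := ltnP 1 (ndist k j); last first.
  apply: le_trans (integral_riesz_le x (ltnW p2) r0 mB (block_volume _ _ l0)) _.
  rewrite lee_fin -/(riesz_cst R p) ler_peMr//.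
  by case: (ndist k j) t1 => [|[|//]] _; lra.
apply: le_trans (@integral_riesz_far _ p x r ((ndist k j).-1%:R) _ p2 r0 _ mB
  (block_volume _ _ l0) _) _.
- by rewrite ler1n; move: t2; case: (ndist k j) => [|[|]].
- by move=> z; exact: block_far.
rewrite lee_fin; case: (ndist k j) t2 => [//|[//|t]] _ /=.
apply: (@le_trans _ _ (riesz_cst R p * r ^+ 2 / t.+1%:R ^+ 2)).
  rewrite ler_pM2r ?invr_gt0 ?exprn_gt0// ler_pM2r ?exprn_gt0//.
  by rewrite ler_peMr ?exprn_ge0// lerDl exprn_ge0.
rewrite ler_wpM2l//.
rewrite -!natr1; have := ler0n R t; move: (t%:R : R) => s s0.
rewrite ler_pdivlMr ?mulr_gt0//; try lra.
rewrite mulrC ler_pdivrMr ?exprn_gt0//; last by lra.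
by nra.
Qed.

(** On block [k] the potential is at most $lam^2/k^2$, which cancels the scale $((k+1)/lam)^2$ of
    the kernel integral up to $((k+1)/k)^2 \le 4$. This gives 48 per block, and the sum over
    distances doubles it to 96, uniformly in [x] and [lam]. *)
Lemma parabV_potential_le (R : realType) p (lam : R) (x : 'rV[R]_p.+2) :
  (2 <= p)%N -> 0 < lam ->
  (\int[lebesgue_rV R p.+2]_z (parabV lam z * (enorm (z - x) ^+ p)^-1)%:E
    <= (96 * riesz_cst R p)%:E)%E.
Proof.
move=> p2 l0; set mu := lebesgue_rV R p.+2.
have rc0 : 0 <= riesz_cst R p.
  by rewrite mulr_ge0 ?exprn_ge0// addr_ge0// exprn_ge0.
have [j jx] : exists j : nat,
    j%:R ^+ 2 <= Num.max 0 (lam * x ord0 ord0) < j.+1%:R ^+ 2.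
  by apply: sqrt_floor; rewrite le_max lexx.
have blk k := @block_riesz_le _ _ _ k _ x p2 l0 jx.
move: (riesz_cst R p) rc0 blk => C rc0 blk.
(* Division by zero makes [w 0 = 0]; this is harmless, since $lam z_1 > 4$ keeps the parabola off
   block 0. *)
pose w k : R := lam ^+ 2 / k%:R ^+ 2.
have w0 k : 0 <= w k by rewrite divr_ge0 ?sqr_ge0.
pose g k (z : 'rV[R]_p.+2) := ((w k)%:E * (((enorm (z - x) ^+ p)^-1)%:E *
   (\1_(@block R p.+1 lam k) z)%:E) : \bar R)%E.
have g0 k z : (0 <= g k z)%E.
  by rewrite !mule_ge0// lee_fin// riesz_ge0.
have mh k : measurable_fun setT (fun z : 'rV[R]_p.+2 =>
   (((enorm (z - x) ^+ p)^-1)%:E * (\1_(@block R p.+1 lam k) z)%:E)%E).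
  under eq_fun do rewrite -EFinM.
  apply/measurable_EFinP; apply: measurable_funM; first exact: measurable_riesz.
  by apply: measurable_indic; exact: measurable_tube.
have mg k : measurable_fun setT (g k) by exact: measurable_funeM.
have step1 : (\int[mu]_z (parabV lam z * (enorm (z - x) ^+ p)^-1)%:E <=
    \int[mu]_z (\sum_(0 <= k <oo) g k z))%E.
  apply: ge0_le_integral => //.
  - by move=> z _; rewrite lee_fin mulr_ge0 ?riesz_ge0 ?parabV_ge0.
  - apply/measurable_EFinP; apply: measurable_funM; last exact: measurable_riesz.
    exact: measurable_parabV.
  - by apply: ge0_emeasurable_sum => // *; exact: g0.
  move=> z _; rewrite /parabV indicE; case: (boolP (z \in _)) => [|_]; last first.
    by rewrite mulr0 mul0r nneseries_ge0.
  rewrite inE mulr1 => Az; have z0 := parabola_gt0 l0 Az.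
  case: Az => z4 zA.
  have [k /andP[kz zk]] := sqrt_floor (ltW (mulr_gt0 l0 z0)).
  have k0 : (0 < k)%N.
    case: k kz zk => // _; rewrite expr1n => h; exfalso; lra.
  apply: (@le_trans _ _ (g k z)); last first.
    have := @nneseries_lim_ge R (fun k => g k z) xpredT 0 k.+1 (fun i _ _ => g0 i z).
    by apply: le_trans; rewrite big_nat_recr//= leeDr// sume_ge0.
  rewrite /g indicE mem_set ?mule1 -?EFinM ?lee_fin.
    rewrite ler_wpM2r ?riesz_ge0// /w.
    rewrite ler_pdivrMr// mulrAC ler_pdivlMr ?exprn_gt0 ?ltr0n//.
    by rewrite expr2 -mulrA ler_pM2l.
  apply/tubeP; split.
    by rewrite ler_pdivrMr// ler_pdivlMr// ![_ * lam]mulrC kz ltW.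
  (* From $lam z_1 < (k+1)^2$ follows $\sqrt{z_1/lam} \le (k+1)/lam$, the half-width of the
     block. *)
  move=> i; have := norm_coord_le_enorm (col' ord0 z) i; rewrite mxE => /le_trans; apply.
  rewrite (le_trans zA)// -[leRHS]ger0_norm ?divr_ge0 ?(ltW l0)// -sqrtr_sqr.
  rewrite ler_sqrt ?exprn_ge0 ?divr_ge0 ?(ltW l0)// expr_div_n.
  rewrite ler_pdivlMr ?exprn_gt0// expr2 mulrA divfK ?gt_eqF//.
  by rewrite mulrC ltW.
apply: le_trans step1 _.
rewrite integral_nneseries//.
apply: (@le_trans _ _ (\sum_(0 <= k <oo) (48 * C *
    ((ndist k j).+1%:R * (ndist k j).+2%:R)^-1)%:E)%E); last first.
  apply: nneseries_EFin_le => [k|N].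
    by apply: mulr_ge0; [exact: mulr_ge0|rewrite invr_ge0 mulr_ge0].
  rewrite -mulr_sumr (_ : 96 * _ = 48 * C * 2); last by lra.
  by apply: ler_wpM2l; [exact: mulr_ge0|exact: sum_inv_ndist_le].
apply: lee_nneseries => [k _ _|k _]; first by apply: integral_ge0 => z _; exact: g0.
rewrite ge0_integralZl_EFin//; last first.
  by move=> z _; rewrite mule_ge0 ?lee_fin ?riesz_ge0.
have -> : (\int[mu]_z (((enorm (z - x) ^+ p)^-1)%:E *
      (\1_(@block R p.+1 lam k) z)%:E) =
    \int[mu]_(z in block lam k) ((enorm (z - x) ^+ p)^-1)%:E)%E.
  rewrite [RHS]integral_mkcond; apply: eq_integral => z _.
  by rewrite patchE indicE; case: ifP => _; rewrite ?mule1 ?mule0.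
apply: le_trans (lee_wpmul2l _ (blk k)) _; first by rewrite lee_fin.
rewrite -EFinM lee_fin mulrA ler_wpM2r ?invr_ge0 ?mulr_ge0//.
rewrite /w; have [->|k0] := posnP k.
  rewrite expr0n/= invr0 mulr0 mul0r; exact: mulr_ge0.
have kR : 1 <= k%:R :> R by rewrite ler1n.
have -> : lam ^+ 2 / k%:R ^+ 2 * (12 * C * (k.+1%:R / lam) ^+ 2) =
    12 * C * (k.+1%:R / k%:R) ^+ 2.
  by field; rewrite !gt_eqF// ltr0n.
rewrite (_ : 48 * C = 12 * C * 2 ^+ 2); last by ring.
rewrite ler_wpM2l ?mulr_ge0//.
rewrite lerXn2r ?nnegrE ?divr_ge0// ler_pdivrMr ?(lt_le_trans _ kR)// -natr1.
lra.
Qed.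

(** Absolute values are moved under the integral; [newton_const] is a real number, so the bound
    stays finite whatever its value. *)
Lemma inv_laplacian_norm_lt_pinfty (R : realType) d (V : 'rV[R]_d -> R) (M : R) :
  measurable_fun setT V ->
  (forall x, (\int[lebesgue_rV R d]_z
     (`|V z| * (enorm (z - x) ^+ (d - 2))^-1)%:E <= M%:E)%E) ->
  (inv_laplacian_norm V < +oo)%E.
Proof.
move=> mV VM; apply: (@le_lt_trans _ _ (`|newton_const R d| * M)%:E); last exact: ltry.
apply: ge_ereal_sup => _ [x _ <-].
rewrite /inv_laplacian abseN abseM abse_EFin EFinM.
apply: lee_wpmul2l; first by rewrite lee_fin.
apply: le_trans (VM x).
apply: (le_trans (le_abse_integral _ _ _)) => //.
  by apply/measurable_EFinP; apply: measurable_funM => //; exact: measurable_riesz.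
rewrite le_eqVlt; apply/orP; left; apply/eqP; apply: eq_integral => z _.
by rewrite abse_EFin normrM [`|_^-1|]ger0_norm// riesz_ge0.
Qed.

(** * Lower bounds on the K-norm *)

Lemma measurable_kerK (R : realType) d (x y : 'rV[R]_d) :
  measurable_fun setT (fun z : 'rV[R]_d => kerK (z - x) y).
Proof.
have me := measurable_enorm_sub x.
have mc (c : R) : measurable_fun setT (fun z : 'rV[R]_d => enorm (z - x) * c).
  by apply: measurable_funM => //; exact: measurable_cst.
have md : measurable_fun setT (fun z : 'rV[R]_d => dotp (z - x) y).
  rewrite (_ : (fun _ => _) =
      (fun z : 'rV[R]_d => \sum_i (z ord0 i - x ord0 i) * y ord0 i)).
    apply: measurable_sum => i; apply: measurable_funM; last exact: measurable_cst.
    by apply: measurable_funB; [exact: measurable_coord|exact: measurable_cst].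
  by apply/funext => z; apply: eq_bigr => i _; rewrite !mxE.
have m1 : measurable_fun setT (fun z : 'rV[R]_d =>
    expR (- (enorm (z - x) * enorm y - dotp (z - x) y) / 2)).
  apply: measurableT_comp; first exact: measurable_expR.
  apply: measurable_funM; last exact: measurable_cst.
  by apply: measurableT_comp => //; exact: measurable_funB.
have m2 : measurable_fun setT (fun z : 'rV[R]_d =>
    (1 + enorm (z - x) * enorm y) `^ (d%:R / 2 - 3 / 2)).
  apply: (measurableT_comp (measurable_powR _)).
  by apply: measurable_funD => //; exact: measurable_cst.
have m3 := measurable_funM m1 (measurable_riesz (d - 2) x).
exact: (measurable_funM m3 m2).
Qed.

Lemma kerK_ge0 (R : realType) d (x y : 'rV[R]_d) : 0 <= kerK x y.
Proof.
rewrite mulr_ge0 ?powR_ge0// divr_ge0 ?expR_ge0//.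
by rewrite exprn_ge0// enorm_ge0.
Qed.

(** The vector $lam\, e_1$, taken as [y] when the K-norm is tested. *)
Definition axis (R : realType) n (lam : R) : 'rV[R]_n.+1 :=
  \row_i (if i == ord0 then lam else 0).

Lemma enorm_axis (R : realType) n (lam : R) : 0 <= lam ->
  enorm (@axis R n lam) = lam.
Proof.
move=> l0; rewrite /enorm big_ord_recl mxE eqxx big1 => [|i _].
  by rewrite addr0 sqrtr_sqr ger0_norm.
by rewrite mxE eq_sym (negbTE (neq_lift _ _)) expr0n.
Qed.

Lemma dotp_axis (R : realType) n (lam : R) (z : 'rV[R]_n.+1) :
  dotp z (axis n lam) = lam * z ord0 ord0.
Proof.
rewrite /dotp big_ord_recl mxE eqxx big1 => [|i _]; first by rewrite addr0 mulrC.
by rewrite mxE eq_sym (negbTE (neq_lift _ _)) mulr0.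
Qed.

(** On the parabola $|z|^2 \le z_1^2 + z_1/lam \le (z_1 + 1/lam)^2$. Hence $lam(|z| - z_1) \le 1$,
    which keeps the exponential in [kerK] above $e^{-1/2}$. *)
Lemma enorm_parabola_le (R : realType) n (lam : R) (z : 'rV[R]_n.+1) :
  0 < lam -> parabola lam z -> enorm z <= z ord0 ord0 + lam^-1.
Proof.
move=> l0 Az; have z0 := parabola_gt0 l0 Az; case: Az => _ zA.
have il0 : 0 < lam^-1 by rewrite invr_gt0.
rewrite -(ler_pXn2r (_ : 0 < 2)%N)// ?nnegrE ?enorm_ge0 ?addr_ge0 ?(ltW z0) ?(ltW il0)//.
have -> : enorm z ^+ 2 = z ord0 ord0 ^+ 2 + enorm (col' ord0 z) ^+ 2.
  rewrite !sqr_enorm big_ord_recl; congr (_ + _).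
  by apply: eq_bigr => i _; rewrite mxE.
have : enorm (col' ord0 z) ^+ 2 <= z ord0 ord0 / lam.
  rewrite -[leRHS]sqr_sqrtr ?divr_ge0 ?(ltW z0) ?(ltW l0)//.
  by rewrite lerXn2r ?nnegrE ?enorm_ge0 ?sqrtr_ge0.
by move: (enorm _ ^+ 2) (z ord0 ord0) z0 => e a a0 h; nra.
Qed.

(** The division by [n.+1] keeps the Euclidean norm of the cross-section below $q/lam$, which is at
    most $\sqrt{z_1/lam}$ when $lam z_1 \ge q^2$. *)
Definition slab (R : realType) n (lam q : R) : set 'rV[R]_n.+1 :=
  tube (q ^+ 2 / lam) (2 * q ^+ 2 / lam) (q / (n.+1%:R * lam)).

Lemma slab_parabola (R : realType) n (lam q : R) : 0 < lam -> 4 <= q ->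
  @slab R n lam q `<=` parabola lam.
Proof.
move=> l0 q4 z /tubeP[/andP[z1 z2] zj].
have z16 : 16 <= lam * z ord0 ord0.
  by move: z1; rewrite ler_pdivrMr// mulrC; nra.
split; first lra.
have q0 : 0 <= q by lra.
have z0 : 0 < z ord0 ord0 by rewrite -(pmulr_rgt0 _ l0); lra.
apply: (@le_trans _ _ (q / lam)); last first.
  rewrite -[leLHS]ger0_norm ?divr_ge0 ?(ltW l0)// -sqrtr_sqr ler_wsqrtr//.
  by rewrite expr_div_n [lam ^+ 2]expr2 invfM mulrA ler_pM2r ?invr_gt0.
rewrite -(ler_pXn2r (_ : 0 < 2)%N)// ?nnegrE ?enorm_ge0 ?divr_ge0 ?(ltW l0)//.
rewrite sqr_enorm.
apply: (@le_trans _ _ (\sum_(i < n) (q / lam) ^+ 2 / n.+1%:R)).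
  apply: ler_sum => i _; rewrite mxE -real_normK ?num_real//.
  apply: (@le_trans _ _ ((q / (n.+1%:R * lam)) ^+ 2)).
    by rewrite lerXn2r ?nnegrE// (le_trans _ (zj i)).
  rewrite invfM mulrCA exprMn mulrC ler_wpM2l ?sqr_ge0// expr2 ler_piMr//.
  by rewrite invf_le1// ler1n.
rewrite sumr_const card_ord -mulrnAr ler_piMr ?sqr_ge0//.
by rewrite -mulr_natl ler_pdivrMr// mul1r ler_nat.
Qed.

(** The three factors are bounded separately: the exponential by $e^{-1/2}$, the norm by $|z| \le
    (2q^2+1)/lam \le 4q^2/lam$, and the last one through $1 + lam|z| \ge q^2$, whose exponent is
    $p/2$ in dimension $p+3$. *)
Lemma kerK_slab_ge (R : realType) p (lam q : R) (z : 'rV[R]_p.+3) :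
  0 < lam -> 4 <= q -> slab lam q z ->
  expR (- 2^-1) / (4 * q ^+ 2 / lam) ^+ p.+1 * q ^+ p
    <= kerK (z - 0) (axis p.+2 lam).
Proof.
move=> l0 q4 Bz; have Az := slab_parabola l0 q4 Bz.
have z0 := parabola_gt0 l0 Az.
have ez := enorm_parabola_le l0 Az.
have /tubeP[/andP[z1 z2] _] := Bz.
have ze : z ord0 ord0 <= enorm z.
  by rewrite (le_trans _ (norm_coord_le_enorm z ord0))// ler_norm.
have e0 : 0 < enorm z by exact: lt_le_trans ze.
have q0 : 0 < q by lra.
have lz : 4 < lam * z ord0 ord0 by case: Az.
have c0 : 0 < 4 * q ^+ 2 / lam by rewrite divr_gt0// mulr_gt0// exprn_gt0.
rewrite /kerK subr0 enorm_axis ?(ltW l0)// dotp_axis.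
apply: ler_pM.
- by rewrite divr_ge0 ?expR_ge0// exprn_ge0// ltW.
- by rewrite exprn_ge0// ltW.
- apply: ler_pM; rewrite ?expR_ge0//.
  + by rewrite invr_ge0 exprn_ge0// ltW.
  + rewrite ler_expR mulNr lerN2 ler_pdivrMr// mulVf// lerBlDr.
    move: ez; rewrite -(ler_pM2r l0) mulrDl mulVf ?gt_eqF// [lam * _]mulrC.
    by rewrite addrC.
  + rewrite !subSS subn0 lef_pV2 ?posrE ?exprn_gt0//.
    rewrite lerXn2r ?nnegrE ?(ltW e0) ?(ltW c0)//.
    apply: (le_trans ez); rewrite ler_pdivlMr// mulrDl mulVf ?gt_eqF//.
    by move: z2; rewrite ler_pdivlMr//; nra.
have -> : q ^+ p = (q ^+ 2) `^ (p%:R / 2).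
  by rewrite -[q ^+ 2]powR_mulrn ?(ltW q0)// -powRrM mulrCA mulfV// mulr1 powR_mulrn// ltW.
have -> : p.+3%:R / 2 - 3 / 2 = p%:R / 2 :> R.
  by rewrite -!natr1; lra.
apply: ge0_ler_powR; rewrite ?divr_ge0 ?nnegrE ?sqr_ge0//.
  by rewrite addr_ge0// mulr_ge0// ltW.
move: z1; rewrite ler_pdivrMr// => z1.
have : z ord0 ord0 * lam <= enorm z * lam by rewrite ler_pM2r.
lra.
Qed.

(** The product of the lower bound $lam^2/(2q^2)$ on [parabV], the lower bound on the kernel and the
    volume of the slab; all powers of [lam] and [q] cancel. *)
Definition slab_cst (R : realType) p : R :=
  expR (- 2^-1) / 2 / 4 ^+ p.+1 * (2 / p.+3%:R) ^+ p.+2.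

Lemma slab_cst_gt0 (R : realType) p : 0 < slab_cst R p.
Proof.
by rewrite mulr_gt0 ?exprn_gt0 ?divr_gt0 ?exprn_gt0 ?expR_gt0.
Qed.

(** The integrand is bounded below by a constant on the slab. The weight [w] covers both [potV],
    with [w = 1], and the pieces of [compactV], with [w] equal to $2^{-j}$. *)
Lemma integral_slab_ge (R : realType) p (lam q w : R) (V : 'rV[R]_p.+3 -> R) :
  0 < lam -> 4 <= q -> 0 <= w -> measurable_fun setT V ->
  (forall z, slab lam q z -> w * parabV lam z <= `|V z|) ->
  ((w * slab_cst R p)%:E <= \int[lebesgue_rV R p.+3]_(z in slab lam q)
    (`|V z| * kerK (z - 0) (axis p.+2 lam))%:E)%E.
Proof.
move=> l0 q4 w0 mV wV; set mu := lebesgue_rV R p.+3.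
have q0 : 0 < q by lra.
have mS : measurable (@slab R p.+2 lam q) by exact: measurable_tube.
pose k := w * (lam ^+ 2 / (2 * q ^+ 2)) *
  (expR (- 2^-1) / (4 * q ^+ 2 / lam) ^+ p.+1 * q ^+ p).
have a0 : 0 <= w * (lam ^+ 2 / (2 * q ^+ 2)).
  by rewrite mulr_ge0// divr_ge0 ?sqr_ge0// mulr_ge0// sqr_ge0.
have b0 : 0 <= expR (- 2^-1) / (4 * q ^+ 2 / lam) ^+ p.+1 * q ^+ p.
  rewrite mulr_ge0 ?exprn_ge0 ?(ltW q0)// divr_ge0 ?expR_ge0// exprn_ge0//.
  by rewrite divr_ge0 ?(ltW l0)// mulr_ge0// sqr_ge0.
have k0 : 0 <= k by exact: mulr_ge0.
have -> : ((w * slab_cst R p)%:E = \int[mu]_(z in slab lam q) cst k%:E z)%E.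
  transitivity (k%:E * mu (slab lam q))%E; last by rewrite integral_cst.
  have -> : mu (slab lam q) = ((2 * q ^+ 2 / lam - q ^+ 2 / lam) *
      (2 * (q / (p.+3%:R * lam))) ^+ p.+2)%:E.
    apply: lebesgue_tube.
      by rewrite ler_pM2r ?invr_gt0// ler_peMl ?sqr_ge0// ler1n.
    by rewrite divr_ge0 ?mulr_ge0 ?(ltW q0) ?(ltW l0).
  rewrite -EFinM; congr EFin; rewrite /k /slab_cst.
  have p0 : p.+3%:R != 0 :> R by rewrite pnatr_eq0.
  move: (p.+3%:R) p0 => n n0.
  rewrite !exprMn !exprVn !exprMn !exprS; field.
  have [lN0 qN0] : lam != 0 /\ q != 0 by rewrite !gt_eqF.
  by rewrite !expf_neq0 ?lN0 ?qN0 ?n0 ?pnatr_eq0.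
apply: ge0_le_integral => //.
- apply/measurable_EFinP; apply: measurable_funM.
    apply: measurableT_comp; first exact: normr_measurable.
    exact: measurable_funS mV.
  exact: measurable_funS (measurable_kerK _ _).
move=> z Bz; rewrite lee_fin /k; apply: ler_pM => //; last exact: kerK_slab_ge.
apply: le_trans (wV _ Bz); rewrite ler_wpM2l//.
have Az := slab_parabola l0 q4 Bz; have z0 := parabola_gt0 l0 Az.
rewrite /parabV indicE mem_set// mulr1 ler_pdivlMr//.
rewrite mulrAC ler_pdivrMr ?mulr_gt0 ?exprn_gt0// expr2 -!mulrA ler_pM2l//.
have /tubeP[/andP[_ z2] _] := Bz; move: z2; rewrite ler_pdivlMr// mulrC.
by [].
Qed.

(** The supremum is tested at [x = 0] and [y = axis p.+2 lam]. Successive values of $q = 2^{k+2}$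
    double, so $2q_i^2 < 4q_i^2 \le q_j^2$ for $i < j$; the slabs are disjoint and their
    contributions add up. *)
Lemma normK_ge (R : realType) p (lam w : R) (N : nat) (V : 'rV[R]_p.+3 -> R) :
  0 < lam -> 0 <= w -> measurable_fun setT V ->
  (forall k z, (k < N)%N -> slab lam (2 ^+ k.+2) z ->
    w * parabV lam z <= `|V z|) ->
  ((N%:R * (w * slab_cst R p))%:E <= normK V)%E.
Proof.
move=> l0 w0 mV wV; apply: le_ereal_sup_tmp.
set mu := lebesgue_rV R p.+3.
pose f (z : 'rV[R]_p.+3) := (`|V z| * kerK (z - 0) (axis p.+2 lam))%:E.
exists (\int[mu]_z f z)%E; first by exists 0 => //; exists (axis p.+2 lam).
have f0 z : (0 <= f z)%E by rewrite lee_fin mulr_ge0// kerK_ge0.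
have mf : measurable_fun setT f.
  apply/measurable_EFinP; apply: measurable_funM; last exact: measurable_kerK.
  by apply: measurableT_comp; first exact: normr_measurable.
pose B k := @slab R p.+2 lam (2 ^+ k.+2).
have mB k : measurable (B k) by exact: measurable_tube.
have q4 k : 4 <= 2 ^+ k.+2 :> R.
  by rewrite -natrX ler_nat (@leq_pexp2l 2 2 k.+2).
pose s := index_iota 0 N.
have tB : trivIset [set` s] B.
  apply/trivIsetP => i j _ _.
  wlog ij : i j / (i < j)%N.
    move=> h; case: (ltngtP i j) => // [ij|ji] _; first by apply: h => //; rewrite neq_ltn ij.
    by rewrite setIC; apply: h => //; rewrite neq_ltn ji.
  move=> _; apply/seteqP; split=> // z [].
  move=> /tubeP[/andP[_ iz] _] /tubeP[/andP[jz _] _].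
  have := le_trans jz iz; rewrite ler_pM2r ?invr_gt0// leNgt => /negP; apply.
  have : 2 * 2 ^+ i.+2 <= 2 ^+ j.+2 :> R.
    by rewrite -exprS -!natrX ler_nat leq_exp2l.
  by have := q4 i; move: (2 ^+ i.+2 : R) (2 ^+ j.+2 : R) => a b; nra.
apply: (@le_trans _ _ (\int[mu]_(z in \big[setU/set0]_(k <- s) B k) f z)%E); last first.
  by apply: ge0_subset_integral => //; exact: bigsetU_measurable.
rewrite ge0_integral_bigsetU ?iota_uniq//; last exact: measurable_funS mf.
rewrite (_ : N%:R * _ = \sum_(k <- s) (w * slab_cst R p)); last first.
  by rewrite big_const_nat subn0 iter_addr_0 mulr_natl.
rewrite -sumEFin !big_seq; apply: lee_sum => k; rewrite mem_index_iota => /andP[_ kN].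
by apply: integral_slab_ge => // z; exact: wV.
Qed.

(** * The compactly supported potential *)

(* Makes the slabs q = 2^(k+2), k < 4^j, satisfy 2 q^2 / scale j <= 2^-j. *)
Definition scale (R : realType) j : R := 32 * 4 ^+ (4 ^ j) * 2 ^+ j.

Lemma scale_gt0 (R : realType) j : 0 < scale R j.
Proof. by rewrite mulr_gt0 ?exprn_gt0// mulr_gt0 ?exprn_gt0. Qed.

(** The weight $2^{-j}$ makes the potentials summable; the cut bounds the support and leaves
    finitely many nonzero terms at each point. *)
Definition cut_parabV (R : realType) n j (z : 'rV[R]_n.+1) : R :=
  2^-1 ^+ j * (parabV (scale R j) z *
    \1_[set z : 'rV[R]_n.+1 | z ord0 ord0 <= 2^-1 ^+ j] z).

Lemma half_exprn_ge0 (R : realType) j : 0 <= 2^-1 ^+ j :> R.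
Proof. by rewrite exprn_ge0// invr_ge0. Qed.

Lemma cut_parabV_ge0 (R : realType) n j (z : 'rV[R]_n.+1) : 0 <= cut_parabV j z.
Proof.
apply: mulr_ge0; first exact: half_exprn_ge0.
by apply: mulr_ge0 => //; exact/parabV_ge0/scale_gt0.
Qed.

Lemma measurable_cut_parabV (R : realType) n j :
  measurable_fun setT (@cut_parabV R n j).
Proof.
have mi : measurable [set z : 'rV[R]_n.+1 | z ord0 ord0 <= 2^-1 ^+ j].
  have := @measurable_coord R n.+1 ord0 measurableT _
    (measurable_itv `]-oo, 2^-1 ^+ j]).
  by rewrite setTI (_ : _ @^-1` _ = [set z : 'rV[R]_n.+1 | z ord0 ord0 <= 2^-1 ^+ j]).
have m1 := measurable_funM (@measurable_parabV R n _ (scale_gt0 R j))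
  (measurable_indic (D := setT) mi).
have m2 : measurable_fun setT (fun _ : 'rV[R]_n.+1 => (2^-1 : R) ^+ j).
  exact: measurable_cst.
exact: (measurable_funM m2 m1).
Qed.

Lemma cut_parabV_neq0 (R : realType) n j (z : 'rV[R]_n.+1) :
  cut_parabV j z != 0 -> parabola (scale R j) z /\ z ord0 ord0 <= 2^-1 ^+ j.
Proof.
rewrite /cut_parabV /parabV !mulf_eq0 !negb_or => /and3P[_ /andP[_ h1] h2].
split.
  by move: h1; rewrite indicE pnatr_eq0 eqb0 negbK inE.
by move: h2; rewrite indicE pnatr_eq0 eqb0 negbK inE.
Qed.

Lemma half_exprn_small (R : realType) (e : R) : 0 < e ->
  exists J, forall j, (J <= j)%N -> 2^-1 ^+ j < e.
Proof.
move=> e0; exists (Num.truncn e^-1).+1 => j Jj.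
rewrite exprVn -[ltRHS]invrK ltf_pV2 ?posrE ?invr_gt0 ?exprn_gt0//.
apply: (lt_trans (truncnS_gt _)); rewrite -natrX ltr_nat.
by rewrite (leq_ltn_trans Jj)// ltn_expl.
Qed.

(** Kept in the extended reals, where nonnegative series are measurable and commute with the
    integral. *)
Definition sum_parabV (R : realType) n (z : 'rV[R]_n.+1) : \bar R :=
  (\sum_(0 <= j <oo) (cut_parabV j z)%:E)%E.

Lemma sum_parabV_ge0 (R : realType) n (z : 'rV[R]_n.+1) : (0 <= sum_parabV z)%E.
Proof. by apply: nneseries_ge0 => j _ _; rewrite lee_fin cut_parabV_ge0. Qed.

(* All terms with 2^-j < z_1 vanish. *)
Lemma sum_parabV_fin_num (R : realType) n (z : 'rV[R]_n.+1) :
  sum_parabV z \is a fin_num.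
Proof.
have [J hJ] : exists J, forall j, (J <= j)%N -> cut_parabV j z = 0.
  have [z0|z0] := leP (z ord0 ord0) 0.
    exists 0%N => j _; apply/eqP/negPn/negP => /cut_parabV_neq0[/parabola_gt0].
    by move=> /(_ (scale_gt0 R j)); rewrite ltNge z0.
  have [J hJ] := half_exprn_small z0; exists J => j /hJ hj.
  by apply/eqP/negPn/negP => /cut_parabV_neq0[_]; rewrite leNgt hj.
rewrite /sum_parabV (@nneseries_split _ _ 0 J); last first.
  by move=> j _; rewrite lee_fin cut_parabV_ge0.
rewrite add0n [X in (_ + X)%E]eseries0 => [|j Jj _]; last by rewrite hJ.
by rewrite adde0 sumEFin.
Qed.

Definition compactV (R : realType) n (z : 'rV[R]_n.+1) : R :=
  - fine (sum_parabV z).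

Lemma measurable_sum_parabV (R : realType) n :
  measurable_fun setT (@sum_parabV R n).
Proof.
apply: ge0_emeasurable_sum => [j z _ _|j _].
  by rewrite lee_fin cut_parabV_ge0.
by apply/measurable_EFinP; exact: measurable_cut_parabV.
Qed.

Lemma measurable_compactV (R : realType) n :
  measurable_fun setT (@compactV R n).
Proof.
have mf := measurableT_comp (fine_measurable measurableT) (@measurable_sum_parabV R n).
exact: (measurableT_comp (@oppr_measurable R setT) mf).
Qed.

Lemma compactV_le0 (R : realType) n (z : 'rV[R]_n.+1) : compactV z <= 0.
Proof. by rewrite oppr_le0 fine_ge0// sum_parabV_ge0. Qed.

Lemma normr_compactV (R : realType) n (z : 'rV[R]_n.+1) :
  (`|compactV z|%:E = sum_parabV z)%E.
Proof.
by rewrite normrN ger0_norm ?fine_ge0 ?sum_parabV_ge0// fineK ?sum_parabV_fin_num.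
Qed.

(** Where some term is nonzero, $0 < z_1 \le 2^{-j} \le 1$, and $|z_2| \le 1$ because the scale is
    at least 1. The support thus lies in the cube $[-1,1]^d$. *)
Lemma compact_support_compactV (R : realType) n :
  compact (closure [set z : 'rV[R]_n.+1 | compactV z != 0]).
Proof.
pose B : set 'rV[R]_n.+1 := [set v | forall i, `[(-1 : R), 1]%classic (v ord0 i)].
have cB : compact B := @rV_compact _ _ (fun=> `[(-1 : R), 1]%classic)
  (fun=> @segment_compact R (-1) 1).
have clB : closed B := compact_closed (@norm_hausdorff R 'rV[R]_n.+1) cB.
set S := [set z | _].
suff SB : S `<=` B.
  have cSB := closure_subset SB; rewrite -[X in _ `<=` X](closure_id B).1// in cSB.
  exact: subclosed_compact (@closed_closure _ S) cB cSB.
move=> z /= Vz i.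
have [j /cut_parabV_neq0[Az zj]] : exists j, cut_parabV j z != 0.
  apply/not_existsP => h; move/eqP: Vz; apply.
  rewrite /compactV /sum_parabV eseries0 ?oppr0// => j _ _.
  by congr EFin; apply/eqP/negPn/negP; exact: h.
have z0 := parabola_gt0 (scale_gt0 R j) Az; case: Az => _ zA.
have z1 : z ord0 ord0 <= 1.
  by rewrite (le_trans zj)// exprn_ile1// ?invr_ge0// invf_le1// ler1n.
have s1 : 1 <= scale R j.
  rewrite /scale -!natrX -!natrM ler1n !muln_gt0 !expn_gt0 //.
rewrite /= in_itv/= -ler_norml.
case: (unliftP ord0 i) => [k|] ->; last by rewrite gtr0_norm.
have := norm_coord_le_enorm (col' ord0 z) k; rewrite mxE => /le_trans; apply.
rewrite (le_trans zA)// -[leRHS]sqrtr1 ler_wsqrtr// ler_pdivrMr ?scale_gt0//.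
by rewrite mul1r (le_trans z1).
Qed.

(** Cutting only decreases [parabV], whose potential is bounded uniformly in the scale; the factor 2
    bounds the sum of the weights $2^{-j}$. *)
Lemma compactV_potential_le (R : realType) p (x : 'rV[R]_p.+2) : (2 <= p)%N ->
  (\int[lebesgue_rV R p.+2]_z (`|compactV z| * (enorm (z - x) ^+ p)^-1)%:E
    <= (96 * riesz_cst R p * 2)%:E)%E.
Proof.
move=> p2; set mu := lebesgue_rV R p.+2.
have rc0 : 0 <= 96 * riesz_cst R p.
  apply: mulr_ge0 => //; apply: mulr_ge0; first by rewrite exprn_ge0.
  by apply: addr_ge0 => //; rewrite exprn_ge0.
pose g j (z : 'rV[R]_p.+2) := (cut_parabV j z * (enorm (z - x) ^+ p)^-1)%:E.
have g0 j z : (0 <= g j z)%E.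
  by rewrite lee_fin mulr_ge0 ?cut_parabV_ge0 ?riesz_ge0.
have mg j : measurable_fun setT (g j).
  apply/measurable_EFinP; apply: measurable_funM; last exact: measurable_riesz.
  exact: measurable_cut_parabV.
have -> : (\int[mu]_z (`|compactV z| * (enorm (z - x) ^+ p)^-1)%:E =
    \int[mu]_z (\sum_(0 <= j <oo) g j z))%E.
  apply: eq_integral => z _; rewrite EFinM normr_compactV muleC.
  rewrite -nneseriesZl => [|j _]; last by rewrite lee_fin cut_parabV_ge0.
  by apply: eq_eseriesr => j _; rewrite -EFinM mulrC.
rewrite integral_nneseries//.
apply: (@le_trans _ _ (\sum_(0 <= j <oo) (96 * riesz_cst R p * 2^-1 ^+ j)%:E)%E).
  apply: lee_nneseries => [j _ _|j _]; first exact: integral_ge0.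
  have mP : measurable_fun setT (fun z : 'rV[R]_p.+2 =>
      (parabV (scale R j) z * (enorm (z - x) ^+ p)^-1)%:E).
    apply/measurable_EFinP; apply: measurable_funM; last exact: measurable_riesz.
    exact: measurable_parabV (scale_gt0 R j).
  have P0 (z : 'rV[R]_p.+2) :
      (0 <= (parabV (scale R j) z * (enorm (z - x) ^+ p)^-1)%:E)%E.
    by rewrite lee_fin mulr_ge0 ?riesz_ge0// parabV_ge0// scale_gt0.
  have le1 : (\int[mu]_z g j z <= \int[mu]_z ((2^-1 ^+ j)%:E *
      (parabV (scale R j) z * (enorm (z - x) ^+ p)^-1)%:E))%E.
    apply: ge0_le_integral => //; first exact: measurable_funeM.
    move=> z _; rewrite -EFinM lee_fin [leRHS]mulrA ler_wpM2r ?riesz_ge0//.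
    apply: ler_wpM2l; first exact: half_exprn_ge0.
    by rewrite ler_piMr//; exact/parabV_ge0/scale_gt0.
  apply: (le_trans le1); rewrite ge0_integralZl_EFin ?half_exprn_ge0//.
  rewrite mulrC EFinM; apply: lee_wpmul2l; first by rewrite lee_fin half_exprn_ge0.
  by apply: parabV_potential_le => //; exact: scale_gt0.
apply: nneseries_EFin_le => [j|N]; first by apply: mulr_ge0 => //; exact: half_exprn_ge0.
by rewrite -mulr_sumr; apply: ler_wpM2l => //; exact: sum_half_le.
Qed.

(** For $q = 2^{k+2}$ the upper end is $2q^2 = 32 \cdot 4^k \le 32 \cdot 4^{4^j}$, and dividing by
    the scale leaves $2^{-j}$. *)
Lemma slab_cut_le (R : realType) n j k (z : 'rV[R]_n.+1) : (k < 4 ^ j)%N ->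
  slab (scale R j) (2 ^+ k.+2) z -> z ord0 ord0 <= 2^-1 ^+ j.
Proof.
move=> kj /tubeP[/andP[_]]; rewrite ler_pdivlMr ?scale_gt0// => h _.
rewrite exprVn -[leRHS]div1r ler_pdivlMr ?exprn_gt0//.
have s0 : 0 < 32 * 4 ^+ (4 ^ j) :> R by rewrite mulr_gt0 ?exprn_gt0.
rewrite -(ler_pM2r s0) mul1r -mulrA [2 ^+ j * _]mulrC.
apply: (le_trans h); rewrite (_ : 2 * _ = 32 * 4 ^+ k); last first.
  by rewrite -exprM mulnC exprM (_ : 2 ^+ 2 = 4 :> R); [rewrite !exprS|]; ring.
by rewrite ler_wpM2l// ler_weXn2l ?ler1n// ltnW.
Qed.

(** The [j]-th term alone offers $4^j$ slabs, each contributing $2^{-j} c$. The total $2^j c$ is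
    unbounded in [j]. *)
Lemma normK_compactV (R : realType) p : normK (@compactV R p.+2) = +oo%E.
Proof.
apply: eq_infty => r; set c := slab_cst R p.
have c0 : 0 < c by exact: slab_cst_gt0.
have [j rj] : exists j : nat, r / c <= 2 ^+ j.
  exists (Num.truncn (r / c)).+1; apply: (le_trans (ltW (truncnS_gt _))).
  by rewrite -natrX ler_nat ltnW// ltn_expl.
have := @normK_ge R p (scale R j) (2^-1 ^+ j) (4 ^ j) (@compactV R p.+2) (scale_gt0 R j)
  (half_exprn_ge0 R j) (@measurable_compactV R p.+2).
rewrite -/c; have -> : (4 ^ j)%:R * (2^-1 ^+ j * c) = 2 ^+ j * c.
  rewrite mulrA natrX -exprMn; congr (_ ^+ _ * _).
  by field.
move=> h; apply: le_trans (h _) => [|k z kj Bz].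
  by rewrite lee_fin -ler_pdivrMr.
rewrite -lee_fin normr_compactV.
have -> : 2^-1 ^+ j * parabV (scale R j) z = cut_parabV j z.
  by rewrite /cut_parabV indicE mem_set ?mulr1//=; exact: slab_cut_le Bz.
have u0 i : (0 <= (cut_parabV i z)%:E)%E by rewrite lee_fin cut_parabV_ge0.
have := @nneseries_lim_ge R (fun i => (cut_parabV i z)%:E) xpredT 0 j.+1
  (fun i _ _ => u0 i).
by apply: le_trans; rewrite big_nat_recr//= leeDr// sume_ge0.
Qed.

(** * The explicit potential and the conclusion *)

(** At scale 1 there is no cut, so any number of slabs is available. *)
Lemma normK_potV (R : realType) p : measurable_fun setT (@potV R p.+2) ->
  normK (@potV R p.+2) = +oo%E.
Proof.
move=> mV; apply: eq_infty => r; set c := slab_cst R p.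
have c0 : 0 < c by exact: slab_cst_gt0.
apply: le_trans (@normK_ge R p 1 1 (Num.truncn (r / c)).+1 _ _ _ mV _) => //.
  by rewrite lee_fin mul1r -ler_pdivrMr// ltW// truncnS_gt.
by move=> k z _ _; rewrite mul1r potVE normrN ler_norm.
Qed.

Unset Implicit Arguments.

Theorem proposition1p5 (R : realType) (n : nat) (hd : (4 <= n.+1)%N) :
  ((inv_laplacian_norm (@potV R n) < +oo)%E /\ normK (@potV R n) = +oo%E) /\
  exists V : 'rV[R]_n.+1 -> R,
    [/\ measurable_fun [set: 'rV[R]_n.+1] V,
        forall z, V z <= 0,
        compact (closure [set z | V z != 0]),
        (inv_laplacian_norm V < +oo)%E
      & normK V = +oo%E].
Proof.
(* The ambient dimension becomes [p.+4], so the kernel exponent is [p.+2], as the potential bounds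
   require. *)
case: n hd => [|[|[|p]]]// _.
have mpot : measurable_fun setT (@potV R p.+3).
  rewrite (_ : @potV R p.+3 = -%R \o parabV 1); last by apply/funext => z; exact: potVE.
  exact: (measurableT_comp (@oppr_measurable R setT) (measurable_parabV ltr01)).
split; first split.
- apply: (@inv_laplacian_norm_lt_pinfty _ _ _ (96 * riesz_cst R p.+2)) => // x.
  under eq_integral do rewrite potVE normrN ger0_norm ?parabV_ge0//.
  exact: parabV_potential_le.
- exact: normK_potV.
exists (@compactV R p.+3); split.
- exact: measurable_compactV.
- exact: compactV_le0.
- exact: compact_support_compactV.
- apply: (@inv_laplacian_norm_lt_pinfty _ _ _ (96 * riesz_cst R p.+2 * 2)) => [|x].
    exact: measurable_compactV.
  exact: compactV_potential_le.
- exact: normK_compactV.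
Qed.
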